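(* Let $C$ be a proper cone. The following are equivalent: (1) The pair $(C,C)$ has the Lorentz factorization property (LFP). (2) The cone $C$ is isomorphic to a direct sum of Lorentz cones.
   Context: All vector spaces are real and finite-dimensional. A convex cone $C\subseteq V$ is proper if it is closed, pointed ($C\cap(-C)=\{0\}$) and generating (it spans $V$). Two cones are isomorphic if there is a linear bijection between their linear spans mapping one onto the other. A cone $C$ is a direct sum of convex cones $C_1,C_2$ if $\operatorname{span}(C_1)\cap\operatorname{span}(C_2)=\{0\}$ and $C=C_1+C_2$ (similarly for several summands). For $n\ge 1$ the Lorentz cone is $L_n=\{(t,x_1,\dots,x_{n-1})\in\mathbb{R}^n : t\ge (x_1^2+\cdots+x_{n-1}^2)^{1/2}\}$; a cone is Lorentzian if it is isomorphic to some $L_n$. For proper cones $C_1\subseteq V_1$, $C_2\subseteq V_2$, $\mathrm{Pos}(C_1,C_2)$ is the set of linear maps $P:V_1\to V_2$ with $P(C_1)\subseteq C_2$, and $\mathrm{LorFact}(C_1,C_2)=\operatorname{conv}\{\beta\alpha : \alpha\in\mathrm{Pos}(C_1,L),\ \beta\in\mathrm{Pos}(L,C_2),\ L \text{ a Lorentzian cone}\}$. The pair $(C_1,C_2)$ has the Lorentz factorization property (LFP) if $\mathrm{LorFact}(C_1,C_2)=\mathrm{Pos}(C_1,C_2)$. *)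

(* Defs.v *)
From HB Require Import structures.
From mathcomp Require Import all_boot all_order all_algebra.
From mathcomp Require Import all_classical all_reals all_analysis.

Set Implicit Arguments.
Unset Strict Implicit.
Unset Printing Implicit Defensive.

Import Order.TTheory GRing.Theory Num.Theory.
Import numFieldNormedType.Exports.

Local Open Scope classical_set_scope.
Local Open Scope ring_scope.

Definition convex_cone (R : realType) (V : vectType R) (C : set V) : Prop :=
  [/\ C 0,
      forall x y, C x -> C y -> C (x + y)
    & forall (a : R) x, 0 <= a -> C x -> C (a *: x)].

Definition lspan (R : realType) (V : vectType R) (C : set V) : set V :=
  [set x : V | exists2 s : seq V, [set` s] `<=` C & x \in << s >>%VS].

(* A [vectType] carries no topology; its unique Hausdorff vector space topology
   is the one transported from row vectors by coordinates in any basis. *)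
Definition vclosed (R : realType) (V : vectType R) (C : set V) : Prop :=
  closed (passmx.vecof (vbasis {:V}) @^-1` C : set 'rV[R]_(\dim {:V})).

Definition proper_cone (R : realType) (V : vectType R) (C : set V) : Prop :=
  [/\ convex_cone C,
      vclosed C,
      C `&` [set - x | x in C] = [set 0]
    & lspan C = setT].

(* A linear map between the spans is given by the restriction of a linear map
   between the ambient spaces (every linear map on a subspace extends). *)
Definition cone_isomorphic (R : realType) (V W : vectType R)
    (C : set V) (D : set W) : Prop :=
  exists f : 'Hom(V, W), set_bij (lspan C) (lspan D) f /\ f @` C = D.

(* In the usual indexing by dimension this is L_(n+1), so that [n] ranges over
   all naturals. *)
Definition lorentz_cone (R : realType) (n : nat) : set 'rV[R]_n.+1 :=
  [set v : 'rV[R]_n.+1 |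
     Num.sqrt (\sum_(i < n) v 0 (lift ord0 i) ^+ 2) <= v 0 ord0].

Definition lorentzian (R : realType) (V : vectType R) (C : set V) : Prop :=
  exists n : nat, cone_isomorphic C (@lorentz_cone R n).

(* For two summands the first condition reads [lspan D0 `&` lspan D1 = [set 0]].
   The empty family ([k = 0]) is allowed, and has direct sum [[set 0]]. *)
Definition direct_sum (R : realType) (V : vectType R) (k : nat)
    (D : 'I_k -> set V) (C : set V) : Prop :=
  (forall i : 'I_k,
     lspan (D i) `&` lspan (\bigcup_(j in [set j | j != i]) D j) = [set 0]) /\
  C = [set x : V | exists2 y : 'I_k -> V,
                     (forall i, D i (y i)) & x = \sum_(i < k) y i].

Definition convex_hull (R : realType) (E : lmodType R) (A : set E) : set E :=
  [set x : E | exists (m : nat) (a : 'I_m -> R) (v : 'I_m -> E),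
     [/\ forall i, 0 <= a i, \sum_(i < m) a i = 1,
         forall i, A (v i) & x = \sum_(i < m) a i *: v i]].

Definition Pos (R : realType) (V1 V2 : vectType R) (C1 : set V1) (C2 : set V2)
    : set 'Hom(V1, V2) :=
  [set P : 'Hom(V1, V2) | P @` C1 `<=` C2].

(* Being Lorentzian is intrinsic to the span; properness of [L] adds that [L]
   generates its ambient space [W], as required of the arguments of [Pos]. *)
Definition LorFact (R : realType) (V1 V2 : vectType R)
    (C1 : set V1) (C2 : set V2) : set 'Hom(V1, V2) :=
  convex_hull
    [set P : 'Hom(V1, V2) |
       exists (W : vectType R) (L : set W)
              (alpha : 'Hom(V1, W)) (beta : 'Hom(W, V2)),
         [/\ lorentzian L, proper_cone L, Pos C1 L alpha, Pos L C2 beta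
           & P = (beta \o alpha)%VF]].

Definition LFP (R : realType) (V1 V2 : vectType R)
    (C1 : set V1) (C2 : set V2) : Prop :=
  LorFact C1 C2 = Pos C1 C2.

(* Main.v *)
(** If the identity of C factors, it is a sum of positive maps P_j = b_j a_j
    through Lorentz cones.  The operators S with c - S and c + S positive for
    some real c form an algebra in which every square is positive (a limit of
    Bernstein polynomials with positive coefficients) and no nonzero element
    has square zero.  Hence every element that is not a scalar produces a
    nontrivial idempotent, namely the projection onto the kernel of S - t,
    where t is the largest real with S - t positive.  Splitting 1 as far as
    possible gives positive orthogonal idempotents e with sum 1 such that each
    e P_j e is a multiple of e, and for some j a positive one.  Then
    a_j identifies e(C) with a linear section of a Lorentz cone, which is
    Lorentzian.  Conversely, the identity of a direct sum of Lorentz cones is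
    the sum of the projections to the summands. *)

Require Import Defs.
From HB Require Import structures.
From mathcomp Require Import all_boot all_order all_algebra.
From mathcomp Require Import all_classical all_reals all_analysis.
From mathcomp Require Import ring lra.

Set Implicit Arguments.
Unset Strict Implicit.
Unset Printing Implicit Defensive.

Import Order.TTheory GRing.Theory Num.Theory.
Import numFieldNormedType.Exports.
Local Open Scope classical_set_scope.
Local Open Scope ring_scope.

(** * Ordered matrix algebras *)

Section OrderedMatrixAlgebra.
Variables (R : realType) (n : nat).
Local Notation E := 'M[R]_n.+1.
Variable K : set E.
Hypotheses (K1 : K 1) (KD : forall x y, K x -> K y -> K (x + y)).
Hypothesis KZ : forall (a : R) x, 0 <= a -> K x -> K (a *: x).
Hypothesis KM : forall x y, K x -> K y -> K (x * y).
Hypothesis Kanti : forall x, K x -> K (- x) -> x = 0.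
Hypothesis Karch : forall x y, (forall e : R, 0 < e -> K (x + e *: y)) -> K x.

Let K0 : K 0. Proof. by rewrite -(scale0r 1); exact: KZ. Qed.

Let Keq x y : K x -> x = y -> K y.
Proof. by move=> ? <-. Qed.

Let Ksum (I : Type) (r : seq I) (P : pred I) (F : I -> E) :
  (forall i, P i -> K (F i)) -> K (\sum_(i <- r | P i) F i).
Proof. by move=> KF; elim/big_ind: _. Qed.

(** [1] need not be an order unit of the whole matrix algebra, so the arguments are confined to the
    elements that its multiples bound on both sides. *)
Definition order_bounded (S : E) :=
  exists c : R, K (c%:A - S) /\ K (c%:A + S).

(** Products of matrices are first replaced by fresh variables; the remaining linear identity is
    checked entrywise by [ring]. *)
Local Ltac mx_lin :=
  repeat match goal with |- context [@GRing.mul ?T ?x ?y] =>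
    let t := type of x in tryif unify t (R : Type) then fail else
    (let z := fresh "z" in set z := (@GRing.mul _ x y); clearbody z) end;
  apply/matrixP => ? ?; rewrite !mxE; ring.

(** Used with [a = 1]: a bound [c >= 1] can be inverted in later rescalings. *)
Lemma order_bounded_ub S (a : R) : order_bounded S ->
  exists c : R, [/\ a <= c, K (c%:A - S) & K (c%:A + S)].
Proof.
move=> [c [h1 h2]]; exists (Num.max a c).
have h : K ((Num.max a c - c)%:A).
  by apply: KZ K1; rewrite subr_ge0 le_max lexx orbT.
split; first by rewrite le_max lexx.
- by have := KD h h1; rewrite addrA -scalerDl subrK.
- by have := KD h h2; rewrite addrA -scalerDl subrK.
Qed.

Lemma order_boundedC (a : R) : order_bounded a%:A.
Proof.
exists `|a|; rewrite -scalerBl -scalerDl; split; apply: KZ K1.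
  by rewrite subr_ge0 ler_norm.
by rewrite addrC -lerBlDr sub0r lerNl -normrN ler_norm.
Qed.

Lemma order_boundedD S T :
  order_bounded S -> order_bounded T -> order_bounded (S + T).
Proof.
move=> [c [h1 h2]] [d [k1 k2]]; exists (c + d); split.
  by rewrite scalerDl opprD addrACA; exact: KD.
by rewrite scalerDl addrACA; exact: KD.
Qed.

Lemma order_boundedN S : order_bounded S -> order_bounded (- S).
Proof. by move=> [c [h1 h2]]; exists c; rewrite opprK. Qed.

(** Twice [cd - ST] is [(c + S)(d - T) + (c - S)(d + T)], and twice [cd + ST] is
    [(c + S)(d + T) + (c - S)(d - T)]. *)
Lemma order_boundedM S T :
  order_bounded S -> order_bounded T -> order_bounded (S * T).
Proof.
move=> [c [h1 h2]] [d [k1 k2]]; exists (c * d).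
have half x : K (x + x) -> K x.
  move=> /(@KZ 2^-1); rewrite -mulr2n -(scaler_nat 2 x) scalerA mulVf ?pnatr_eq0//.
  by rewrite scale1r; apply; rewrite invr_ge0.
have eqcd : (c * d)%:A = c%:A * d%:A :> E by rewrite -scalerAl mul1r scalerA.
rewrite eqcd; split; apply: half.
  have := KD (KM h2 k1) (KM h1 k2); move/Keq; apply.
  by rewrite mulrBr mulrBl !mulrDl !mulrDr; mx_lin.
have := KD (KM h2 k2) (KM h1 k1); move/Keq; apply.
by rewrite !mulrDr !mulrDl !(mulrN, mulNr) opprK; mx_lin.
Qed.

Lemma order_bounded_horner S p : order_bounded S -> order_bounded (horner_mx S p).
Proof.
move=> hS; elim/poly_ind: p => [|p c IH].
  by rewrite rmorph0 -(scale0r 1); exact: order_boundedC.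
rewrite rmorphD rmorphM/= horner_mx_X horner_mx_C; apply: order_boundedD.
  exact: order_boundedM.
by rewrite -scalemx1; exact: order_boundedC.
Qed.

(* Conditioning on the last of n + 1 Bernoulli trials of success rate P: the
   polynomial below is the second moment about s of the binomial law. *)
Lemma pos_binomial_moment P : K P -> K (1 - P) -> forall m (s : R),
  K (horner_mx P ((m%:R *: 'X - s%:P) ^+ 2 + m%:R *: ('X * (1 - 'X)))).
Proof.
move=> hP h1P; elim=> [|m IH] s.
  rewrite !scale0r sub0r addr0 sqrrN -rmorphXn/= horner_mx_C -scalemx1.
  by apply: KZ K1; exact: sqr_ge0.
(* If [Q m s] denotes the polynomial, then [Q (m + 1) s = X Q m (s - 1) + (1 - X) Q m s]. Writing
   [P] and [1 - P] as polynomials in [P] lets [ring] check this in a commutative ring. *)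
have := KD (KM hP (IH (s - 1))) (KM h1P (IH s)).
rewrite -[X in K (X * _ + _)](horner_mx_X P).
rewrite -[X in K (_ + (1 - X) * _)](horner_mx_X P).
rewrite -[X in K (_ + (X - _) * _)](rmorph1 (horner_mx P)).
rewrite -rmorphB -!rmorphM -rmorphD/=; move/Keq; apply.
congr (horner_mx _ _).
by rewrite -!mul_polyC !polyC_natr polyCB polyC1 -[in RHS]natr1; ring.
Qed.

(** The second moment about [m t], divided by the square of [m], is [(P - t)^2 + P(1 - P)/m];
    [Karch] removes the last term. *)
Lemma pos_sqr_unit_interval P (t : R) :
  K P -> K (1 - P) -> K ((P - t%:A) ^+ 2).
Proof.
move=> hP h1P; apply: (@Karch _ (P * (1 - P))) => e e0.
pose m := (Num.trunc e^-1).+1.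
have m0 : 0 < m%:R :> R by rewrite ltr0n.
have em : m%:R^-1 <= e.
  rewrite -[e]invrK lef_pV2 ?posrE ?invr_gt0//; apply: ltW.
  by rewrite truncnS_gt.
(* The multiple [e - 1/m] of [P (1 - P)] is added to bring its coefficient from [1/m] to exactly
   [e]. *)
have := KD (KZ (sqr_ge0 m%:R^-1) (pos_binomial_moment hP h1P m (m%:R * t)))
   (KZ (_ : 0 <= e - m%:R^-1) (KM hP h1P)).
rewrite subr_ge0 => /(_ em) /Keq; apply.
have hQ : horner_mx P ('X * (1 - 'X)) = P * (1 - P).
  by rewrite rmorphM rmorphB rmorph1/= horner_mx_X.
rewrite rmorphD rmorphXn rmorphB/= !horner_mxZ hQ.
rewrite horner_mx_X horner_mx_C -scalemx1 -[(_ * t) *: _]scalerA -scalerBr.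
rewrite exprZn scalerDr !scalerA -exprMn mulVf ?lt0r_neq0// expr1n scale1r.
rewrite expr2 -mulrA mulVf ?lt0r_neq0// mulr1.
by rewrite -addrA -scalerDl addrC addrCA subrr addr0 addrC.
Qed.

(** The element [P = (c + S)/(2c)] lies between 0 and 1, and [S = 2c (P - 1/2)]. *)
Lemma pos_sqr S : order_bounded S -> K (S ^+ 2).
Proof.
move=> /(order_bounded_ub 1) [c [c1 h1 h2]].
have c0 : 0 < 2 * c by rewrite mulr_gt0// (lt_le_trans _ c1).
have c2 : (2 * c)^-1 * c = 2^-1 by rewrite invfM mulfVK// gt_eqF// (lt_le_trans _ c1).
have u0 : 0 <= (2 * c)^-1 by rewrite invr_ge0 ltW.
pose P := (2 * c)^-1 *: (c%:A + S).
have h1P : K (1 - P).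
  apply: (Keq (KZ u0 h1)); rewrite scalerBr /P scalerDr opprD addrA.
  congr (_ - _); rewrite scalerA c2 -[X in _ = X - _](scale1r 1) -scalerBl.
  by congr (_ *: _); lra.
have := KZ (sqr_ge0 (2 * c)) (pos_sqr_unit_interval (2^-1) (KZ u0 h2) h1P).
move=> /Keq; apply; rewrite scalerDr scalerA c2 addrC addKr.
by rewrite (exprZn _ S) scalerA -exprMn mulfV ?gt_eqF// expr1n scale1r.
Qed.

(** If [T] has square 0, then [(T + 2e)^2 / (4e) = T + e] is positive for every [e > 0], so [T] is
    positive. This applies to both [S] and [-S]. *)
Lemma sqr_eq0_order_bounded S : order_bounded S -> S ^+ 2 = 0 -> S = 0.
Proof.
have aux T : order_bounded T -> T ^+ 2 = 0 -> K T.
  move=> bT T20.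
  have sq (a : R) : (T + a%:A) ^+ 2 = (a + a) *: T + (a ^+ 2)%:A.
    rewrite expr2 mulrDr mulrDl [_ * a%:A]mulrDl -[T * T]expr2 T20 add0r.
    by rewrite -!scalerAl -!scalerAr !mul1r !mulr1 scalerA addrA -scalerDl.
  apply: (@Karch _ 1) => e e0.
  have := pos_sqr (order_boundedD bT (order_boundedC (2 * e))).
  move=> /(KZ (_ : 0 <= (4 * e)^-1)); rewrite invr_ge0 mulr_ge0 ?(ltW e0)//.
  move=> /(_ isT) /Keq; apply.
  have en : e != 0 by rewrite gt_eqF.
  rewrite sq scalerDr !scalerA -[in RHS](scale1r T).
  have -> : (4 * e)^-1 * (2 * e + 2 * e) = 1 by field.
  by have -> : (4 * e)^-1 * (2 * e) ^+ 2 = e by field.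
move=> bS S20; apply: Kanti; first exact: aux.
by apply: aux; [exact: order_boundedN|rewrite sqrrN].
Qed.

(** * Bounded idempotents and their splitting *)

Lemma order_bounded_idem_pos e : order_bounded e -> e * e = e -> K e.
Proof. by move=> /pos_sqr + ee; rewrite expr2 ee. Qed.

(* The zero eigenspace of T has no nilpotent part. *)
Lemma annihilator_simple_root T : order_bounded T ->
  exists g : {poly R}, g.[0] != 0 /\ T * horner_mx T g = 0.
Proof.
move=> bT; have p0 := monic_neq0 (mxminpoly_monic T).
have [/eqP p00|pn0] := boolP (root (mxminpoly T) 0); last first.
  by exists (mxminpoly T); rewrite mx_root_minpoly mulr0.
have /factor_theorem [g pg] : root (mxminpoly T) 0 by apply/eqP.
exists g; rewrite subr0 in pg.
have Tg : T * horner_mx T g = 0.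
  rewrite -{1}(horner_mx_X T) -rmorphM/= mulrC -pg; exact: mx_root_minpoly.
(* If [g] vanished at 0 too, the square of [g(T)] would be a multiple of [T g(T) = 0], so [g(T)]
   would be 0, against the minimality of the degree. *)
split=> //; apply/negP => /factor_theorem [h]; rewrite subr0 => gh.
have : horner_mx T g = 0.
  apply: sqr_eq0_order_bounded; first exact: order_bounded_horner.
  have -> : horner_mx T g ^+ 2 = horner_mx T h * (T * horner_mx T g).
    by rewrite expr2 {1}gh rmorphM/= horner_mx_X mulrA.
  by rewrite Tg mulr0.
have g0 : g != 0 by apply: contra_neq p0; rewrite pg => ->; rewrite mul0r.
by move=> /mxminpoly_min /(dvdp_leq g0); rewrite pg size_mulX// ltnn.
Qed.

(** With [t] the largest real such that [T = S - t e] is positive, [f] is the projection, within the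
    corner of [e], onto the kernel of [T]. If [f = e], then [T = 0] and [S] is a multiple of [e]; if
    [f = 0], then [T] is invertible in the corner and [t] is not maximal. *)
Lemma idempotent_split e S :
  order_bounded e -> e * e = e -> e != 0 ->
  order_bounded S -> K S -> e * S = S -> S * e = S ->
  (forall a, S <> a *: e) ->
  exists f, [/\ order_bounded f, f * f = f, e * f = f, f * e = f & f != 0 /\ f != e].
Proof.
move=> be ee e0 bS KS eS Se Sns.
have Ke := order_bounded_idem_pos be ee.
pose A := [set t : R | K (S - t *: e)].
have supA : has_sup A.
  split; first by exists 0; rewrite /A/= scale0r subr0.
  have [c [h1 _]] := bS; exists c => t At; rewrite leNgt; apply/negP => ct.
  (* Adding [S - t e] and [c e - S] with [t > c] would make [-e] positive. *)
  have /(KD At) : K (c *: e - S).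
    apply: (Keq (KM (KM Ke h1) Ke)).
    by rewrite mulrBr mulrBl -scalerAr mulr1 -scalerAl ee eS Se.
  rewrite addrC subrKA -scalerBl => /(@KZ (t - c)^-1).
  rewrite invr_ge0 subr_ge0 scalerA -(opprB t c) mulrN mulVf ?gt_eqF ?subr_gt0//.
  by rewrite scaleN1r => /(_ (ltW ct)) /(Kanti Ke) /eqP; rewrite (negPf e0).
pose t := sup A; pose T := S - t *: e.
have KT : K T.
  apply: (@Karch _ e) => d d0; have [x Ax xt] := sup_adherent d0 supA.
  apply: (Keq (KD Ax (KZ (_ : 0 <= x - t + d) Ke))).
    by rewrite addrAC subr_ge0 addrC -lerBlDl ltW// -opprB ltrNl opprB.
  by rewrite /T; mx_lin.
have tmax d : 0 < d -> ~ K (T - d *: e).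
  move=> d0 Kd; have /(ub_le_sup supA.2) : A (t + d).
    by rewrite /A/= scalerDl opprD addrA.
  by rewrite -/t gerDl leNgt d0.
have bte : order_bounded (t *: e).
  by rewrite -[e]mul1r scalerAl; apply: order_boundedM => //; exact: order_boundedC.
have bT : order_bounded T.
  by apply: order_boundedD => //; exact: order_boundedN.
have eT : e * T = T by rewrite mulrBr eS -scalerAr ee.
have Te : T * e = T by rewrite mulrBl Se -scalerAl ee.
have T0 : T <> 0 by move=> /eqP; rewrite subr_eq0 => /eqP; exact: Sns.
have [g [g0 Tg]] := annihilator_simple_root bT.
have [r gr] : exists r, g = r * 'X + g.[0]%:P.
  have /factor_theorem [r gr] : root (g - g.[0]%:P) 0.
    by rewrite /root hornerD hornerN hornerC subrr.
  by exists r; rewrite subr0 in gr; rewrite -gr subrK.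
have com p : e * horner_mx T p = horner_mx T p * e.
  by apply: comm_mx_horner; rewrite /comm_mx; exact: (etrans eT (esym Te)).
set G := horner_mx T g in Tg *; set H := horner_mx T r.
have GE : G = H * T + g.[0]%:A.
  by rewrite /G {1}gr rmorphD rmorphM/= horner_mx_X horner_mx_C scalemx1.
have bG p : order_bounded (e * horner_mx T p).
  by apply: order_boundedM => //; exact: order_bounded_horner.
have scb a x : order_bounded x -> order_bounded (a *: x).
  by move=> bx; rewrite -[x]mul1r scalerAl; apply: order_boundedM => //; exact: order_boundedC.
exists (g.[0]^-1 *: (e * G)); split.
- by apply: scb; exact: bG.
- rewrite -scalerAl -scalerAr; congr (_ *: _).
  have -> : e * G * (e * G) = e * (G * G) by rewrite mulrA -(mulrA e G e) -(com g) !mulrA ee.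
  (* Since [T G = 0], only the constant term of the first factor survives. *)
  have -> : G * G = g.[0] *: G.
    by rewrite {1}GE mulrDl -[H * T * G]mulrA Tg mulr0 add0r -scalerAl mul1r.
  by rewrite -scalerAr scalerA mulVf// scale1r.
- by rewrite -scalerAr mulrA ee.
- by rewrite -scalerAl -mulrA -(com g) mulrA ee.
split; apply/eqP; last first.
  move=> fe; apply: T0; rewrite -Te -fe -scalerAr mulrA Te.
  by rewrite Tg scaler0.
move=> /eqP; rewrite scaler_eq0 invr_eq0 (negPf g0)/= => /eqP eG.
(* From [e G = 0] follows [e H T = - g.[0] e], so [Q] is a left inverse of [T] relative to [e]. *)
pose Q := - g.[0]^-1 *: (e * H).
have QT : Q * T = e.
  move: eG; rewrite GE mulrDr -scalerAr mulr1 => /eqP; rewrite addr_eq0 => /eqP eHT.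
  by rewrite -scalerAl -mulrA eHT scalerN scaleNr opprK scalerA mulVf// scale1r.
have Qe : Q * e = Q by rewrite -scalerAl -mulrA -(com r) mulrA ee.
have eQ : e * Q = Q by rewrite -scalerAr mulrA ee.
have bQ : order_bounded Q by apply: scb; exact: bG.
have [M [M1 KM1 _]] := order_bounded_ub 1 bQ.
have M0 : 0 < M by exact: lt_le_trans M1.
(* The product [e (M - Q) T = M T - e] is positive, so [t] could be raised by [1/M]. *)
apply: (tmax M^-1); first by rewrite invr_gt0.
apply: (Keq (KZ (_ : 0 <= M^-1) (KM (KM Ke KM1) KT))).
  by rewrite invr_ge0 ltW.
have -> : e * (M%:A - Q) = M *: e - Q by rewrite mulrBr eQ -scalerAr mulr1.
rewrite (mulrBl T) QT -scalerAl eT scalerBr scalerA mulVf ?scale1r//.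
by rewrite gt_eqF.
Qed.

(** By [f = f e] the row space of [f] lies in that of [e]. If the rank did not drop, [e = D f] would
    give [e f = e], whereas [e f = f]. *)
Lemma idempotent_rank_lt (e f : E) :
  e * f = f -> f * e = f -> f * f = f -> f != e -> (\rank f < \rank e)%N.
Proof.
move=> ef fe ff; apply: contraNT; rewrite -leqNgt => rk.
have fle : (f <= e)%MS by rewrite -fe submxMl.
have /submxP [D eD] : (e <= f)%MS by rewrite -(geq_leqif (mxrank_leqif_sup fle)).
by rewrite -ef {1}eD -[_ *m _]/(D * f) -mulrA ff -[D * f]/(D *m f) -eD.
Qed.

Lemma orthogonal_sum_absorb k (F : 'I_k -> E) e :
  (forall i j, F i * F j = if i == j then F i else 0) -> \sum_i F i = e ->
  forall i, e * F i = F i /\ F i * e = F i.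
Proof.
move=> Fo <- i; rewrite mulr_suml mulr_sumr.
split; rewrite (bigD1 i)//= Fo eqxx big1 ?addr0// => l /negPf li; rewrite Fo.
  by rewrite li.
by rewrite eq_sym li.
Qed.

(** Any bounded idempotent [e] is allowed, for an induction on its rank: a compression [e P_j e]
    that is not a multiple of [e] splits [e] into [f] and [e - f], both of smaller rank. *)
Lemma spectral_resolution (m : nat) (P : 'I_m -> E) :
  (forall j, K (P j)) -> \sum_j P j = 1 ->
  forall e, order_bounded e -> e * e = e ->
  exists k (F : 'I_k -> E),
    [/\ forall i, K (F i) /\ F i != 0, forall i j, F i * F j = if i == j then F i else 0,
        \sum_i F i = e
      & forall i, exists j (a : R), 0 < a /\ F i * P j * F i = a *: F i].
Proof.
move=> KP sumP e; have [r] := ubnP (\rank e).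
elim: r e => // r IH e; rewrite ltnS => rke be ee.
have Ke := order_bounded_idem_pos be ee.
have [->|e0] := eqVneq e 0.
  by exists 0%N, (fun=> 0); split; [by case|by case|by rewrite big_ord0|by case].
have bP j : order_bounded (P j).
  exists 1; rewrite scale1r; split.
    have -> : 1 - P j = \sum_(i | i != j) P i.
      by rewrite -sumP (bigD1 j)//= addrAC subrr add0r.
    exact: Ksum.
  exact: KD.
pose S j := e * P j * e.
have KS j : K (S j) by apply: KM => //; exact: KM.
have sumS : \sum_j S j = e by rewrite -mulr_suml -mulr_sumr sumP mulr1 ee.
have [[j Sj]|] := pselect (exists j, forall a, S j <> a *: e).
  have [|||f [bf ff ef fe [f0 fNe]]] := idempotent_split be ee e0 _ (KS j) _ _ Sj.
  - by do 2?apply: order_boundedM.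
  - by rewrite /S !mulrA ee.
  - by rewrite /S -!mulrA ee.
  have bh : order_bounded (e - f).
    by apply: order_boundedD => //; exact: order_boundedN.
  have hh : (e - f) * (e - f) = e - f.
    by rewrite mulrBl !mulrBr ee ef fe ff subrr subr0.
  have [|||k1 [F1 [F1K F1o F1s F1l]]] := IH f => //.
    exact: leq_trans (idempotent_rank_lt ef fe ff fNe) rke.
  have [|||k2 [F2 [F2K F2o F2s F2l]]] := IH (e - f) => //.
    apply: leq_trans rke; apply: idempotent_rank_lt => //.
    - by rewrite mulrBr ee ef.
    - by rewrite mulrBl ee fe.
    - by rewrite -subr_eq0 addrAC subrr add0r oppr_eq0.
  (* Pieces of [f] and pieces of [e - f] annihilate each other, because each piece absorbs the
     idempotent it comes from and [f (e - f) = 0]. *)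
  have fF1 := orthogonal_sum_absorb F1o F1s.
  have fF2 i : f * F2 i = 0 /\ F2 i * f = 0.
    have [h1 h2] := orthogonal_sum_absorb F2o F2s i.
    split; first by rewrite -h1 mulrA mulrBr fe ff subrr mul0r.
    by rewrite -h2 -mulrA mulrBl ef ff subrr mulr0.
  have split_lshift a : fintype.split (lshift k2 a) = inl a :> 'I_k1 + 'I_k2.
    exact: (unsplitK (inl a)).
  have split_rshift b : fintype.split (rshift k1 b) = inr b :> 'I_k1 + 'I_k2.
    exact: (unsplitK (inr b)).
  exists (k1 + k2)%N, (fun i : 'I_(k1 + k2) => match fintype.split i with inl a => F1 a | inr b => F2 b end).
  split.
  - by move=> i; case: fintype.split => a; [exact: F1K|exact: F2K].
  - move=> i i'; case: (split_ordP i) => a ->; case: (split_ordP i') => b ->.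
    + by rewrite eq_lshift.
    + rewrite eq_lrshift.
      by rewrite -(fF1 a).2 -mulrA (fF2 b).1 mulr0.
    + rewrite eq_rlshift.
      by rewrite -(fF1 b).1 mulrA (fF2 a).2 mul0r.
    + by rewrite eq_rshift.
  - rewrite big_split_ord/=.
    under eq_bigr do rewrite split_lshift.
    under [X in _ + X]eq_bigr do rewrite split_rshift.
    by rewrite F1s F2s addrC subrK.
  - move=> i; case: (split_ordP i) => a _; first exact: F1l.
    exact: F2l.
move=> /forallNP Sns.
have {Sns} Sa j : exists a, S j = a *: e by have /existsNP [a /contrapT] := Sns j; exists a.
have [a aE] := choice Sa.
have age0 j : 0 <= a j.
  rewrite leNgt; apply/negP => aj.
  have : K (- e).
    apply: (Keq (KZ (_ : 0 <= - (a j)^-1) (KS j))).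
      by rewrite oppr_ge0 invr_le0 ltW.
    by rewrite aE scalerA mulNr mulVf ?lt_eqF// scaleN1r.
  by move=> /(Kanti Ke) /eqP; rewrite (negPf e0).
(* The coefficients cannot all vanish, since the [S j] add up to [e], which is nonzero. *)
have [j aj] : exists j, 0 < a j.
  apply/not_existsP => aN; move: e0; rewrite -sumS big1 ?eqxx// => j _.
  rewrite aE (_ : a j = 0) ?scale0r//; apply/eqP; rewrite eq_le age0 andbT.
  by rewrite leNgt; apply/negP/aN.
exists 1%N, (fun=> e); split => //.
- by move=> i i'; rewrite !ord1 eqxx.
- by rewrite big_ord1.
- by move=> _; exists j, (a j); split => //; exact: aE.
Qed.

End OrderedMatrixAlgebra.

(** * The Lorentz form *)

Section LorentzForm.
Variables (R : realType) (n : nat).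
Implicit Types (u x y z : 'rV[R]_n.+1) (a : R).

Definition space_dot x y := \sum_(i < n) x 0 (lift ord0 i) * y 0 (lift ord0 i).

Definition lorentz_form x y := x 0 ord0 * y 0 ord0 - space_dot x y.

Lemma space_dotC x y : space_dot x y = space_dot y x.
Proof. by apply: eq_bigr => i _; rewrite mulrC. Qed.

Lemma space_dotPl a x y z :
  space_dot (a *: x + y) z = a * space_dot x z + space_dot y z.
Proof.
rewrite mulr_sumr -big_split/=; apply: eq_bigr => i _.
by rewrite !mxE mulrDl mulrA.
Qed.

Lemma space_dotDl x y z : space_dot (x + y) z = space_dot x z + space_dot y z.
Proof. by rewrite -[x]scale1r space_dotPl mul1r scale1r. Qed.

Lemma space_dotZl a x z : space_dot (a *: x) z = a * space_dot x z.
Proof.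
rewrite -[a *: x]addr0 space_dotPl [X in _ + X]big1 ?addr0// => i _.
by rewrite mxE mul0r.
Qed.

Lemma space_dot_ge0 x : 0 <= space_dot x x.
Proof. by apply: sumr_ge0 => i _; rewrite -expr2 sqr_ge0. Qed.

Lemma space_dot_eq0 x : space_dot x x = 0 -> forall i, x 0 (lift ord0 i) = 0.
Proof.
move=> /eqP; rewrite psumr_eq0; last by move=> i _; rewrite -expr2 sqr_ge0.
by move=> /allP x0 i; apply/eqP; rewrite -sqrf_eq0 expr2; apply: x0; rewrite mem_index_enum.
Qed.

(** The square of [b x - c y] expands to [b (a b - c^2)], and [b] can be cancelled once [y] has
    nonzero norm. *)
Lemma space_dot_CS x y : space_dot x y ^+ 2 <= space_dot x x * space_dot y y.
Proof.
have [y0|y0] := eqVneq (space_dot y y) 0.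
  rewrite y0 mulr0 [space_dot x y]big1 ?expr0n// => i _.
  by rewrite (space_dot_eq0 y0) mulr0.
have yp : 0 < space_dot y y by rewrite lt_def y0 space_dot_ge0.
set a := space_dot x x; set b := space_dot y y in y0 yp *; set c := space_dot x y.
have : 0 <= b * (a * b - c ^+ 2).
  have := space_dot_ge0 (b *: x + (- c) *: y).
  rewrite space_dotPl space_dotZl !(space_dotC _ (_ + _)) !space_dotPl !space_dotZl.
  rewrite (space_dotC y x) -/a -/b -/c.
  by move=> h; apply: le_trans h _; rewrite le_eqVlt; apply/orP; left; apply/eqP; ring.
by rewrite pmulr_rge0// subr_ge0.
Qed.

Lemma lorentz_coneE x :
  lorentz_cone x <-> 0 <= x 0 ord0 /\ space_dot x x <= x 0 ord0 ^+ 2.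
Proof.
have dE : \sum_(i < n) x 0 (lift ord0 i) ^+ 2 = space_dot x x.
  by apply: eq_bigr => i _; rewrite expr2.
rewrite /lorentz_cone/= dE; split=> [h|[h0 h]].
  have h0 : 0 <= x 0 ord0 by rewrite (le_trans _ h)// sqrtr_ge0.
  split=> //; rewrite -(sqr_sqrtr (space_dot_ge0 x)) ler_sqr// nnegrE.
  by rewrite sqrtr_ge0.
by rewrite -(ger0_norm h0) -sqrtr_sqr ler_wsqrtr.
Qed.

Lemma lorentz_cone_form x :
  lorentz_cone x <-> 0 <= x 0 ord0 /\ 0 <= lorentz_form x x.
Proof. by rewrite lorentz_coneE /lorentz_form subr_ge0 expr2. Qed.

Lemma lorentz_space_dot x y :
  lorentz_cone x -> lorentz_cone y -> space_dot x y <= x 0 ord0 * y 0 ord0.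
Proof.
move=> /lorentz_coneE [x0 xx] /lorentz_coneE [y0 yy]; rewrite leNgt; apply/negP => xy.
have : (x 0 ord0 * y 0 ord0) ^+ 2 < space_dot x y ^+ 2.
  by rewrite ltr_sqr// nnegrE ?mulr_ge0// (le_trans _ (ltW xy))// mulr_ge0.
apply/negP; rewrite -leNgt (le_trans (space_dot_CS x y))// exprMn.
by rewrite ler_pM// space_dot_ge0.
Qed.

Lemma lorentz_coneD x y : lorentz_cone x -> lorentz_cone y -> lorentz_cone (x + y).
Proof.
move=> Lx Ly; have xy := lorentz_space_dot Lx Ly.
move: Lx Ly => /lorentz_coneE [x0 xx] /lorentz_coneE [y0 yy]; apply/lorentz_coneE.
rewrite space_dotDl !(space_dotC _ (x + y)) !space_dotDl (space_dotC y x) !mxE.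
split; nra.
Qed.

Lemma lorentz_coneZ a x : 0 <= a -> lorentz_cone x -> lorentz_cone (a *: x).
Proof.
move=> a0 /lorentz_coneE [x0 xx]; apply/lorentz_coneE; rewrite mxE mulr_ge0//.
rewrite space_dotZl space_dotC space_dotZl mulrA -expr2 exprMn.
by rewrite ler_wpM2l// sqr_ge0.
Qed.

(** The half of the light cone containing [x] is thus read off from the form and an interior vector
    [u], which makes sense within a subspace. Cauchy-Schwarz settles a positive time coordinate and
    a change of sign a negative one; if it is 0, then [x] is 0. *)
Lemma lorentz_form_interior u x : 0 < u 0 ord0 -> 0 < lorentz_form u u ->
  0 <= lorentz_form x x -> (0 <= x 0 ord0) = (0 <= lorentz_form x u).
Proof.
move=> u0 uu xx.
have pos z : 0 < z 0 ord0 -> 0 <= lorentz_form z z -> 0 < lorentz_form z u.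
  move=> z0; rewrite /lorentz_form subr_ge0 subr_gt0 ltNge => zz; apply/negP => zu.
  have : (z 0 ord0 * u 0 ord0) ^+ 2 <= space_dot z u ^+ 2.
    have zu0 : 0 <= z 0 ord0 * u 0 ord0 by rewrite mulr_ge0// ltW.
    by rewrite ler_sqr// nnegrE// (le_trans zu0).
  apply/negP; rewrite -ltNge (le_lt_trans (space_dot_CS z u))//.
  move: uu; rewrite /lorentz_form subr_gt0 => uu.
  apply: (@le_lt_trans _ _ (z 0 ord0 * z 0 ord0 * space_dot u u)).
    by rewrite ler_wpM2r// space_dot_ge0.
  by rewrite exprMn expr2 expr2 ltr_pM2l// mulr_gt0.
have [x0|x0|x0] := ltgtP (x 0 ord0) 0.
- have := pos (- x); rewrite mxE oppr_gt0 => /(_ x0).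
  have -> : lorentz_form (- x) (- x) = lorentz_form x x.
    by rewrite /lorentz_form -scaleN1r space_dotZl space_dotC space_dotZl !mxE; ring.
  have -> : lorentz_form (- x) u = - lorentz_form x u.
    by rewrite -scaleN1r /lorentz_form space_dotZl !mxE; ring.
  by rewrite oppr_gt0 => /(_ xx) /lt_geF ->.
- by apply/esym; rewrite ltW// pos.
- move: xx; rewrite /lorentz_form x0 mul0r sub0r oppr_ge0 => xx.
  have xx0 : space_dot x x = 0 by apply/eqP; rewrite eq_le xx space_dot_ge0.
  rewrite mul0r sub0r oppr_ge0 [space_dot x u]big1 ?lexx// => i _.
  by rewrite space_dot_eq0// mul0r.
Qed.

(** If the form of [x] were nonnegative, a nonzero time coordinate of [x] would violate
    Cauchy-Schwarz, and a zero one would force [x = 0]. *)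
Lemma lorentz_form_neg u x : 0 < lorentz_form u u -> lorentz_form x u = 0 ->
  x != 0 -> lorentz_form x x < 0.
Proof.
move=> uu xu x0; rewrite ltNge; apply/negP => xx; apply/negP: x0; rewrite negbK.
move: uu xu xx; rewrite /lorentz_form subr_gt0 subr_ge0 => uu /eqP.
rewrite subr_eq0 => /eqP xu xx.
have CS := space_dot_CS x u; have sx := space_dot_ge0 x; have su := space_dot_ge0 u.
have t0 : x 0 ord0 = 0.
  apply/eqP/negPn/negP => t0; have t2 : 0 < x 0 ord0 * x 0 ord0.
    by rewrite -expr2 exprn_even_gt0.
  move: CS; rewrite -xu; apply/negP; rewrite -ltNge.
  apply: (@le_lt_trans _ _ (x 0 ord0 * x 0 ord0 * space_dot u u)).
    by rewrite ler_wpM2r.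
  by rewrite exprMn expr2 expr2 ltr_pM2l.
have s0 : space_dot x x = 0.
  by apply/eqP; rewrite eq_le sx andbT (le_trans xx)// t0 mul0r.
apply/eqP/rowP => i; rewrite mxE; case: (unliftP ord0 i) => [j ->|->//].
exact: space_dot_eq0.
Qed.

Lemma lorentz_form_isotropic x : x 0 ord0 = 0 -> lorentz_form x x = 0 -> x = 0.
Proof.
move=> t0; rewrite /lorentz_form t0 mul0r sub0r => /eqP; rewrite oppr_eq0 => /eqP s0.
apply/rowP => i; rewrite mxE; case: (unliftP ord0 i) => [j ->|->//].
exact: space_dot_eq0.
Qed.

Lemma lorentz_formC x y : lorentz_form x y = lorentz_form y x.
Proof. by rewrite /lorentz_form mulrC space_dotC. Qed.

Lemma lorentz_formPl a x y z :
  lorentz_form (a *: x + y) z = a * lorentz_form x z + lorentz_form y z.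
Proof. by rewrite /lorentz_form space_dotPl !mxE; ring. Qed.

End LorentzForm.

(** * Sections of Lorentz cones *)

Lemma linear_lfun (R : realType) (V W : vectType R) (f : V -> W) :
  linear f -> exists F : 'Hom(V, W), F =1 f.
Proof.
move=> fl; pose g : {linear V -> W} := HB.pack f (GRing.isLinear.Build R V W *:%R f fl).
by exists (linfun g) => x; rewrite lfunE.
Qed.

(** Gram-Schmidt: normalise a vector of [M] and continue in its orthogonal complement within [M].
    Positivity is asked on [M] alone because [p] will be the negative of an indefinite form. *)
Lemma orthonormal_basis (R : realType) (V : vectType R) (p : V -> V -> R)
    (M : {vspace V}) :
  (forall x y, p x y = p y x) ->
  (forall a x y z, p (a *: x + y) z = a * p x z + p y z) ->
  (forall x, x \in M -> x != 0 -> 0 < p x x) ->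
  exists n (w : 'I_n -> V),
    [/\ forall i, w i \in M, forall i j, p (w i) (w j) = (i == j)%:R
      & forall x, x \in M -> x = \sum_i p x (w i) *: w i].
Proof.
move=> pC pP; have [r] := ubnP (\dim M).
elim: r M => // r IH M; rewrite ltnS => rM posM.
have [->|M0] := eqVneq M 0%VS.
  exists 0%N, (fun=> 0); split; [by case|by case|move=> x].
  by rewrite memv0 big_ord0 => /eqP.
pose v := vpick M.
have v0 : v != 0 by rewrite vpick0.
have vM : v \in M := memv_pick M.
have pvv := posM v vM v0.
have pZ a x z : p (a *: x) z = a * p x z.
  have p0 : p 0 z = 0.
    by have := pP (-1) 0 0 z; rewrite scaler0 addr0; lra.
  by rewrite -[a *: x]addr0 pP p0 addr0.
have pD x y z : p (x + y) z = p x z + p y z.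
  by rewrite -[x]scale1r pP mul1r scale1r.
pose w0 := (Num.sqrt (p v v))^-1 *: v.
have w0M : w0 \in M by rewrite memvZ.
have pw0 : p w0 w0 = 1.
  rewrite pZ pC pZ mulrA -expr2 exprVn sqr_sqrtr ?ltW// mulVf//.
  by rewrite gt_eqF.
have [f fE] : exists f : 'Hom(V, R^o), f =1 p^~ w0.
  by apply: linear_lfun => a x y; rewrite pP.
have [|x /[!memv_cap]/andP[xM _]|n [w [wM wo wb]]] := IH (M :&: lker f)%VS.
- apply: leq_trans rM; rewrite ltn_neqAle dimvS ?capvSl// andbT.
  apply/negP => /eqP/esym dM.
  have : w0 \in (M :&: lker f)%VS.
    by have /eqP <- : M == (M :&: lker f)%VS by rewrite eq_sym eqEdim capvSl dM leqnn.
  by rewrite memv_cap w0M memv_ker fE pw0 oner_eq0.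
- exact: posM.
have w0w i : p (w i) w0 = 0.
  by have := wM i; rewrite memv_cap memv_ker fE => /andP[_ /eqP].
exists n.+1, (fun i => oapp w w0 (unlift ord0 i)); split.
- move=> i; case: (unliftP ord0 i) => [j _|_] //=.
  by have := wM j; rewrite memv_cap => /andP[].
- move=> i j; case: (unliftP ord0 i) => [i' ->|->]; case: (unliftP ord0 j) => [j' ->|->] /=.
  + by rewrite wo (inj_eq lift_inj).
  + by rewrite w0w.
  + by rewrite pC w0w.
  + by rewrite pw0.
move=> x xM; rewrite big_ord_recl unlift_none/=.
under eq_bigr do rewrite liftK/=.
have yM : x - p x w0 *: w0 \in (M :&: lker f)%VS.
  rewrite memv_cap; apply/andP; split; first by apply: memvB => //; exact: memvZ.
  by rewrite memv_ker fE -scaleNr addrC pP pw0 mulr1 addNr.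
rewrite -[LHS](subrK (p x w0 *: w0)) addrC [X in _ + X](wb _ yM); congr (_ + _).
apply: eq_bigr => i _; congr (_ *: _).
by rewrite -scaleNr addrC pP (pC w0) w0w mulr0 add0r.
Qed.

Lemma lspan_lorentz_cone (R : realType) n : lspan (@lorentz_cone R n) = setT.
Proof.
apply/seteqP; split=> // v _.
pose t := `|v 0 ord0| + 1 + space_dot v v.
pose e : 'rV[R]_n.+1 := delta_mx 0 ord0.
have t1 : 1 + space_dot v v <= v 0 ord0 + t.
  by rewrite /t !addrA -addrA lerDr -lerBlDl sub0r -normrN ler_norm.
have e0 : e 0 ord0 = 1 by rewrite mxE !eqxx.
have es i : e 0 (lift ord0 i) = 0 by rewrite mxE.
have t0 : 0 <= t by rewrite !addr_ge0 ?space_dot_ge0.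
exists [:: v + t *: e; t *: e].
  have teE j : (t *: e) 0 j = t * e 0 j by rewrite mxE.
  have vteE j : (v + t *: e) 0 j = v 0 j + t * e 0 j by rewrite mxE teE.
  move=> x /=; rewrite !inE => /orP[] /eqP ->; apply/lorentz_coneE.
    have -> : space_dot (v + t *: e) (v + t *: e) = space_dot v v.
      by apply: eq_bigr => i _; rewrite vteE es mulr0 addr0.
    rewrite vteE e0 mulr1; have vv := space_dot_ge0 v; split; nra.
  have -> : space_dot (t *: e) (t *: e) = 0.
    by apply: big1 => i _; rewrite teE es mulr0 mul0r.
  by rewrite teE e0 mulr1 sqr_ge0.
by rewrite -{1}[v](addrK (t *: e)); apply: memvB; rewrite memv_span// !inE eqxx ?orbT.
Qed.

Lemma sub_lspan (R : realType) (V : vectType R) (C : set V) : C `<=` lspan C.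
Proof.
move=> x Cx; exists [:: x]; last by rewrite memv_span// inE.
by move=> y /=; rewrite inE => /eqP ->.
Qed.

Lemma lspan_sub (R : realType) (V : vectType R) (C : set V) (U : {vspace V}) :
  C `<=` [set` U] -> lspan C `<=` [set` U].
Proof.
move=> CU x [s sC xs] /=; apply: subvP x xs; apply/span_subvP => y ys.
exact: CU (sC _ ys).
Qed.

Lemma lspan_image (R : realType) (V W : vectType R) (C : set V) (f : 'Hom(V, W)) x :
  lspan C x -> lspan (f @` C) (f x).
Proof.
move=> [s sC xs]; exists (map f s); last by rewrite -limg_span memv_img.
by move=> _ /= /mapP[y ys ->]; exists y => //; exact: sC.
Qed.

Lemma lorentzian_coord (R : realType) (V : vectType R) (D : set V)
    (U : {vspace V}) n (F : 'Hom(V, 'rV[R]_n.+1)) :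
  lspan D = [set` U] ->
  (forall x, x \in U -> F x = 0 -> x = 0) ->
  (forall r, exists2 x, x \in U & F x = r) ->
  (forall x, x \in U -> D x <-> lorentz_cone (F x)) ->
  lorentzian D.
Proof.
move=> lD Finj Fsurj FD; exists n, F; split.
  rewrite lD lspan_lorentz_cone; split => //.
  - move=> x y /[!inE]/= xU yU Fxy; apply/eqP; rewrite -subr_eq0; apply/eqP.
    by apply: Finj; rewrite ?rpredB// linearB/= Fxy subrr.
  - by move=> r _; have [x xU <-] := Fsurj r; exists x.
apply/seteqP; split => [_ [x Dx <-]|r rL].
  by apply/FD => //; have := sub_lspan Dx; rewrite lD.
have [x xU xr] := Fsurj r; exists x => //; apply/FD => //.
by rewrite xr.
Qed.

(* A linear section of a Lorentz cone is again a Lorentz cone if it meets the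
   interior, and a ray otherwise. *)
Lemma lorentz_section (R : realType) (V : vectType R) (D : set V)
    (U : {vspace V}) N (a : 'Hom(V, 'rV[R]_N.+1)) :
  lspan D = [set` U] -> D !=set0 -> U != 0%VS ->
  (forall x, x \in U -> a x = 0 -> x = 0) ->
  (forall x, x \in U -> D x <-> lorentz_cone (a x)) ->
  lorentzian D.
Proof.
move=> lD Dn0 U0 ainj DE.
have DU x : D x -> x \in U.
  by move=> /sub_lspan; rewrite lD.
pose q x y := lorentz_form (a x) (a y).
have qC x y : q x y = q y x by exact: lorentz_formC.
have qP c x y z : q (c *: x + y) z = c * q x z + q y z.
  by rewrite /q linearP/= lorentz_formPl.
have qlin z : exists f : 'Hom(V, R^o), f =1 q^~ z.
  by apply: linear_lfun => c x y; exact: qP.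
have qZ c x z : q (c *: x) z = c * q x z.
  by have [f fE] := qlin z; rewrite -!fE linearZ.
have DEq x : x \in U -> D x <-> 0 <= a x 0 ord0 /\ 0 <= q x x.
  by move=> xU; rewrite DE// lorentz_cone_form.
(* A vector of [U] with positive form is, up to sign, mapped to the interior of the Lorentz cone. *)
have [[u [uU uq0]]|qnp] := pselect (exists u, u \in U /\ 0 < q u u).
  have t0 : a u 0 ord0 != 0.
    apply/negP => /eqP t0; move: uq0; rewrite /q /lorentz_form t0 mul0r sub0r.
    by rewrite oppr_gt0 ltNge space_dot_ge0.
  (* The factor [c] scales [u] to form 1 and makes its time coordinate positive. *)
  pose c := Num.sg (a u 0 ord0) / Num.sqrt (q u u).
  have {uU uq0 t0} [u1 [u1U u1q u1t]] : exists u1, [/\ u1 \in U, q u1 u1 = 1 & 0 < a u1 0 ord0].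
    exists (c *: u); split; first exact: memvZ.
      rewrite qZ qC qZ mulrA -expr2 /c exprMn sqr_sg t0 mul1r.
      by rewrite exprVn sqr_sqrtr ?ltW// mulVf// gt_eqF.
    rewrite linearZ/= mxE /c mulrAC -normrEsg divr_gt0// ?sqrtr_gt0//.
    by rewrite normr_gt0.
  (* On the part of [U] orthogonal to [u1] the form [-q] is positive definite; [u1] followed by an
     orthonormal basis [w] of that part gives Lorentz coordinates on [U]. *)
  have [f fE] := qlin u1.
  have [||x|n [w [wM wo wb]]] :=
      @orthonormal_basis R V (fun x y => - q x y) (U :&: lker f)%VS.
  - by move=> x y; rewrite qC.
  - by move=> b x y z; rewrite qP; ring.
  - rewrite memv_cap memv_ker fE => /andP[xU /eqP xu] x0; rewrite oppr_gt0.
    apply: (lorentz_form_neg _ xu); first by rewrite -/(q u1 u1) u1q.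
    by apply: contra_neq x0 => /ainj; exact.
  have wU i : w i \in U by have := wM i; rewrite memv_cap => /andP[].
  have wu i : q (w i) u1 = 0.
    by have := wM i; rewrite memv_cap memv_ker fE => /andP[_ /eqP].
  have wq i j : q (w i) (w j) = - (i == j)%:R by rewrite -wo opprK.
  have [F FE] : exists F : 'Hom(V, 'rV[R]_n.+1), F =1 fun x =>
      \row_j (if unlift ord0 j is Some i then - q x (w i) else q x u1).
    apply: linear_lfun => b x y; apply/rowP => j; rewrite !mxE.
    by case: unlift => [i|]; rewrite qP//; ring.
  have F0 x : F x 0 ord0 = q x u1 by rewrite FE mxE unlift_none.
  have FS x i : F x 0 (lift ord0 i) = - q x (w i) by rewrite FE mxE liftK.
  pose G (r : 'rV[R]_n.+1) := r 0 ord0 *: u1 + \sum_i r 0 (lift ord0 i) *: w i.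
  have GU r : G r \in U by rewrite rpredD ?memvZ// rpred_sum// => i _; rewrite memvZ.
  have qG r z : q (G r) z = r 0 ord0 * q u1 z + \sum_i r 0 (lift ord0 i) * q (w i) z.
    rewrite qP; congr (_ + _); have [h hE] := qlin z; rewrite -hE linear_sum/=.
    by apply: eq_bigr => i _; rewrite linearZ/= hE.
  have FG r : F (G r) = r.
    apply/rowP => j; case: (unliftP ord0 j) => [i ->|->].
      rewrite FS qG qC wu mulr0 add0r (bigD1 i)//= big1 ?addr0.
        by rewrite wq eqxx mulrN1 opprK.
      by move=> k /negPf ki; rewrite wq ki oppr0 mulr0.
    by rewrite F0 qG u1q mulr1 big1 ?addr0// => k _; rewrite wu mulr0.
  have GF x : x \in U -> G (F x) = x.
    move=> xU; have yM : x - q x u1 *: u1 \in (U :&: lker f)%VS.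
      rewrite memv_cap; apply/andP; split; first by apply: memvB => //; exact: memvZ.
      by rewrite memv_ker fE -scaleNr addrC qP u1q mulr1 addNr.
    rewrite -[RHS](subrK (q x u1 *: u1)) [X in _ = X + _](wb _ yM) addrC /G F0.
    congr (_ + _); apply: eq_bigr => i _; rewrite FS; congr (- _ *: _).
    by rewrite -scaleNr addrC qP (qC u1) wu mulr0 add0r.
  have qF x : x \in U -> q x x = lorentz_form (F x) (F x).
    move=> xU; rewrite -{1}(GF _ xU) qG /lorentz_form (qC u1) -F0; congr (_ + _).
    rewrite -sumrN; apply: eq_bigr => i _.
    by rewrite (qC (w i)) -[q x _]opprK -FS mulrN.
  apply: (lorentzian_coord (F := F) lD) => [x xU Fx0|r|x xU].
  - by rewrite -(GF _ xU) Fx0 /G !mxE scale0r add0r big1// => i _; rewrite mxE scale0r.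
  - by exists (G r).
  (* For [x] of nonnegative form, the time coordinates of [a x] and of [F x], the latter being
     [q x u1], are nonnegative together. *)
  - rewrite DEq// lorentz_cone_form -qF// F0.
    by split=> -[h1 h2]; split=> //; move: h1; rewrite (lorentz_form_interior u1t)// -/(q _ _) u1q.
(* In the remaining case [D] consists of isotropic vectors. Sums of two of them are isotropic as
   well, so any two are orthogonal and hence proportional. *)
have q0 x : D x -> q x x = 0.
  move=> Dx; have xU := DU _ Dx; have [_ qx] := (DEq _ xU).1 Dx.
  apply/eqP; rewrite eq_le qx andbT leNgt; apply/negP => h.
  by apply: qnp; exists x.
have [x Dx x0] : exists2 x, D x & x != 0.
  apply: contrapT => /forall2NP Dn; case/negP: U0; apply/eqP/vspaceP => y.
  apply/idP/idP => [yU|]; last by rewrite memv0 => /eqP ->; exact: mem0v.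
  have : lspan D y by rewrite lD.
  apply: lspan_sub => z Dz /=; rewrite memv0.
  by have [//|/negP] := Dn z; rewrite negbK.
have xU := DU _ Dx.
have t0 : 0 < a x 0 ord0.
  have [ax0 _] := (DEq _ xU).1 Dx.
  rewrite lt_def ax0 andbT; apply: contra_neq x0 => t0.
  by apply: ainj => //; apply: lorentz_form_isotropic => //; exact: q0.
have Dray y : D y -> y = (a y 0 ord0 / a x 0 ord0) *: x.
  move=> Dy; have yU := DU _ Dy; apply/eqP; rewrite -subr_eq0; apply/eqP.
  set c := _ / _; have zU : y - c *: x \in U by rewrite memvB// memvZ.
  apply: ainj => //; apply: lorentz_form_isotropic.
    by rewrite linearB linearZ/= !mxE /c mulfVK ?subrr// gt_eqF.
  have qD v1 v2 v3 : q (v1 + v2) v3 = q v1 v3 + q v2 v3.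
    by rewrite -[v1]scale1r qP mul1r scale1r.
  have xy : q x y = 0.
    have Dxy : D (x + y).
      apply/DE; first exact: memvD.
      by rewrite linearD/=; apply: lorentz_coneD; apply/DE.
    have := q0 _ Dxy; rewrite qD (qC x) (qC y) !qD !q0// (qC y); lra.
  rewrite -/(q _ _) -scaleNr qD qZ (qC y) (qC x) !qD !qZ !q0// (qC y) xy; ring.
(* The time coordinate carries the ray to the one-dimensional Lorentz cone. *)
have [F FE] : exists F : 'Hom(V, 'rV[R]_1), F =1 fun y => \row_j a y 0 ord0.
  by apply: linear_lfun => c y z; apply/rowP => j; rewrite !mxE linearP/= !mxE.
have F0 y : F y 0 ord0 = a y 0 ord0 by rewrite FE mxE.
have Ux y : y \in U -> exists c, y = c *: x.
  move=> yU; have : lspan D y by rewrite lD.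
  move=> /(@lspan_sub _ _ _ <[x]>%VS) /= H; apply/vlineP; apply: H => z Dz /=.
  by apply/vlineP; eexists; exact: Dray.
have aZ c : a (c *: x) 0 ord0 = c * a x 0 ord0 by rewrite linearZ/= mxE.
apply: (lorentzian_coord (F := F) lD) => [y yU Fy0|r|y yU].
- have [c yc] := Ux _ yU; move: Fy0 => /rowP /(_ ord0).
  rewrite F0 yc aZ mxE => /eqP; rewrite mulf_eq0 (gt_eqF t0) orbF => /eqP ->.
  by rewrite scale0r.
- exists ((r 0 ord0 / a x 0 ord0) *: x); first exact: memvZ.
  apply/rowP => j; rewrite FE mxE aZ mulfVK ?gt_eqF//.
  by rewrite [j]ord1; congr (r _ _); apply/val_inj.
- have [c yc] := Ux _ yU; rewrite DEq// lorentz_cone_form F0.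
  have -> : lorentz_form (F y) (F y) = (a y 0 ord0) ^+ 2.
    by rewrite /lorentz_form /space_dot big_ord0 subr0 F0 expr2.
  by rewrite yc qZ qC qZ q0// !mulr0 lexx sqr_ge0.
Qed.

(** * Splitting a cone with the factorization property *)

(** The ring structure used before has positive size; in size 0 all matrices agree and the empty
    family works. *)
Lemma spectral_resolution_mx (R : realType) n (K : set 'M[R]_n) m (P : 'I_m -> 'M[R]_n) :
  K 1%:M -> (forall x y, K x -> K y -> K (x + y)) ->
  (forall (a : R) x, 0 <= a -> K x -> K (a *: x)) ->
  (forall x y, K x -> K y -> K (x *m y)) ->
  (forall x, K x -> K (- x) -> x = 0) ->
  (forall x y, (forall e : R, 0 < e -> K (x + e *: y)) -> K x) ->
  (forall j, K (P j)) -> \sum_j P j = 1%:M ->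
  exists k (F : 'I_k -> 'M[R]_n),
    [/\ forall i, K (F i) /\ F i != 0,
        forall i j, F i *m F j = if i == j then F i else 0,
        \sum_i F i = 1%:M
      & forall i, exists j (a : R), 0 < a /\ F i *m P j *m F i = a *: F i].
Proof.
case: n K P => [|n] K P K1 KD KZ KM Kanti Karch KP sumP.
  exists 0%N, (fun=> 0); split; [by case|by case| |by case].
  by rewrite big_ord0; apply/matrixP => -[].
have b1 : order_bounded K 1 by rewrite -[1]scale1r; exact: order_boundedC.
exact: (spectral_resolution K1 KD KZ KM Kanti Karch KP sumP b1 (mulr1 1)).
Qed.

(** * Endomorphisms preserving a proper cone *)

Section ProperCone.
Import passmx.
Variables (R : realType) (V : vectType R) (C : set V).
Hypothesis hC : proper_cone C.

Let C0 : C 0. Proof. by case: hC => -[]. Qed.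
Let CD x y : C x -> C y -> C (x + y). Proof. by case: hC => -[_ + _] _ _ _; apply. Qed.
Let CZ (a : R) x : 0 <= a -> C x -> C (a *: x).
Proof. by case: hC => -[_ _ +] _ _ _; apply. Qed.

Lemma proper_cone_anti x : C x -> C (- x) -> x = 0.
Proof.
move=> Cx Cnx; case: hC => _ _ CN _.
have : (C `&` [set - y | y in C]) x by split=> //; exists (- x) => //; rewrite opprK.
by rewrite CN.
Qed.

(** [x] is the limit of [x + e y] as [e] decreases to 0, taken in the coordinates in which
    closedness is stated. *)
Lemma proper_cone_arch x y : (forall e : R, 0 < e -> C (x + e *: y)) -> C x.
Proof.
case: hC => _ clC _ _ H.
have B := vbasisP {:V}.
rewrite -[x](passmx.rVofK B).
pose u := passmx.rVof (vbasis {:V}) x; pose w := passmx.rVof (vbasis {:V}) y.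
have vE (e : R) : passmx.vecof (vbasis {:V}) (u + e *: w) = x + e *: y.
  by rewrite linearD linearZ/= !passmx.rVofK.
apply: (@closed_cvg _ _ (0^'+)%R _ (fun e : R => u + e *: w) _ clC); last first.
  have : (fun e : R => u + e *: w) @ (0^'+)%R --> u + 0 *: w.
    apply: cvgD; first exact: cvg_cst.
    by apply: cvgZr_tmp; exact: cvg_at_right_filter.
  by rewrite scale0r addr0.
near=> e; have /H : 0 < e by near: e; exact: nbhs_right_gt.
by rewrite -vE.
Unshelve. all: by end_near. Qed.

Lemma proper_cone_hom0 (W : vectType R) (f : 'Hom(V, W)) :
  (forall x, C x -> f x = 0) -> f = 0.
Proof.
move=> f0; apply/lfunP => x; rewrite lfunE/=; apply/eqP; rewrite -memv_ker.
have : lspan C x by case: hC => _ _ _ ->.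
by apply: lspan_sub => y Cy /=; rewrite memv_ker f0.
Qed.

Let b := vbasis {:V}.
Let B : basis_of {:V} b := vbasisP {:V}.

Definition pos_mx : set 'M[R]_(\dim {:V}) :=
  [set M | forall x, C x -> C (passmx.hommx b b M x)].

(** The cone [pos_mx] is pointed because [C] is pointed and generating, and archimedean because [C]
    is closed, so the resolution of matrices applies to it. *)
Lemma pos_mx_resolution m (P : 'I_m -> 'End(V)) :
  (forall j x, C x -> C (P j x)) -> \sum_j P j = \1%VF ->
  exists k (e : 'I_k -> 'End(V)),
    [/\ forall i, e i != 0 /\ forall x, C x -> C (e i x),
        forall i j x, e i (e j x) = if i == j then e i x else 0,
        forall x, \sum_i e i x = x
      & forall i, exists j (a : R), 0 < a /\ forall x, e i (P j (e i x)) = a *: e i x].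
Proof.
move=> CP sumP; pose H := passmx.hommx b b : 'M[R]_(\dim {:V}) -> 'End(V).
(* Matrices act on row vectors, so products become compositions in reverse order. *)
have HM M N x : H (M *m N) x = H N (H M x).
  by rewrite /H (passmx.hommx_mul B B B) lfunE.
have H1 x : H 1%:M x = x by rewrite /H passmx.hommx1// lfunE.
have HD M N x : H (M + N) x = H M x + H N x by rewrite /H linearD lfunE.
have HZ a M x : H (a *: M) x = a *: H M x by rewrite /H linearZ lfunE.
have H0 M : (forall x, H M x = 0) -> M = 0.
  move=> M0; apply/eqP; rewrite -(passmx.hommx_eq0 B B); apply/eqP/lfunP => x.
  by rewrite M0 lfunE.
have [|M N CM CN x Cx|a M a0 CM x Cx|M N CM CN x Cx|M CM CNM|M N CMN x Cx|j x Cx||k [F [FK Fo Fs FP]]] :=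
   @spectral_resolution_mx R _ pos_mx m (fun j => passmx.mxof b b (P j)).
- by move=> x; rewrite -/H H1.
- by rewrite -/H HD; apply: CD; [exact: CM|exact: CN].
- by rewrite -/H HZ; apply: CZ => //; exact: CM.
- by rewrite -/H HM; apply: CN; exact: CM.
- apply: H0 => x; have -> : H M = 0.
    apply: proper_cone_hom0 => {}x Cx; apply: proper_cone_anti; first exact: CM.
    by have := CNM x Cx; rewrite -/H -scaleN1r HZ scaleN1r.
  by rewrite lfunE.
- apply: (@proper_cone_arch _ (H N x)) => e e0; rewrite -/H -HZ -HD.
  exact: CMN.
- by rewrite -/H /H passmx.mxofK//; exact: CP.
- by rewrite -linear_sum/= sumP passmx.mxof1// (basis_free B).
exists k, (fun i => H (F i)); split.
- move=> i; have [FiK Fi0] := FK i; split=> //.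
  by rewrite /H passmx.hommx_eq0.
- move=> i j x; rewrite -HM Fo; case: eqVneq => [->//|_].
  by rewrite /H linear0 lfunE.
- by move=> x; rewrite -sum_lfunE -linear_sum Fs H1.
move=> i; have [j [a [a0 FPF]]] := FP i; exists j, a; split=> // x.
rewrite -HZ -FPF !HM; congr (H _ _).
by rewrite /H passmx.mxofK.
Qed.

End ProperCone.

Lemma LFP_lorentz_sum (R : realType) (V : vectType R) (C : set V) :
  proper_cone C -> LFP C C ->
  exists (k : nat) (L : 'I_k -> set V),
    (forall i, lorentzian (L i)) /\ direct_sum L C.
Proof.
move=> hC lfp; have [[C0 CD CZ] _ _ lC] := hC.
have : Pos C C \1%VF by move=> _ [x Cx <-]; rewrite lfunE.
rewrite -lfp => -[m [a [v [a0 _ vL idE]]]].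
(* The convex weights are absorbed into the maps, which stay positive. *)
pose P j := a j *: v j.
have CP j x : C x -> C (P j x).
  move=> Cx; have [W [L [al [be [_ _ hal hbe vE]]]]] := vL j.
  rewrite /P scale_lfunE vE lfunE/=; apply: CZ => //; apply: hbe.
  by exists (al x) => //; apply: hal; exists x.
have [k [e [eC eo es eP]]] := pos_mx_resolution hC CP (esym idE).
have eCC i x : C x -> C (e i x) by have [_ +] := eC i; exact.
have ee i x : e i (e i x) = e i x by rewrite eo eqxx.
exists k, (fun i => [set e i x | x in C]); split.
  move=> i; have [j [l [l0 ePe]]] := eP i; have [ei0 _] := eC i.
  have [W [L [al [be [[N [g [gbij gL]]] pL hal hbe vE]]]]] := vL j.
  have ginj x y : g x = g y -> x = y.
    have [_ _ _ lL] := pL; have [_ gi _] := gbij.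
    by apply: gi; rewrite inE lL.
  have limgE x : x \in limg (e i) -> e i x = x.
    by move=> /memv_imgP [y _ ->].
  have lD : lspan [set e i x | x in C] = [set` limg (e i)].
    apply/seteqP; split.
      by apply: lspan_sub => _ [x Cx <-]; exact: memv_img (memvf _).
    by move=> y /memv_imgP [x _ ->]; apply: lspan_image; rewrite lC.
  (* On the range of [e i] one has [e i (P j x) = l x] with [l > 0], and [P j] factors through [al].
     Hence [al] is injective there, and [al x] in [L] forces [x] into the image of [C] under
     [e i]. *)
  apply: (lorentz_section (a := (g \o al)%VF) lD).
  - by exists (e i 0); exists 0.
  - apply: contra_neq ei0 => U0; apply/lfunP => x; rewrite zero_lfunE.
    have : e i x \in limg (e i) by rewrite memv_img ?memvf.
    by rewrite U0 memv0 => /eqP.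
  - move=> x xU; rewrite lfunE/= => gx0.
    have ax0 : al x = 0 by apply: ginj; rewrite gx0 linear0.
    have Px0 : P j x = 0 by rewrite /P scale_lfunE vE comp_lfunE ax0 linear0 scaler0.
    have := ePe x; rewrite (limgE x xU) Px0 linear0.
    by move=> /esym/eqP; rewrite scaler_eq0 gt_eqF//= => /eqP.
  move=> x xU; rewrite lfunE/=; split.
    move=> [c Cc cx]; rewrite -gL; exists (al x) => //; apply: hal; exists x => //.
    by rewrite -cx; exact: eCC.
  rewrite -gL => -[w Lw /ginj wx].
  exists (l^-1 *: P j x).
    apply: (CZ l^-1); first by rewrite invr_ge0 ltW.
    rewrite /P scale_lfunE vE lfunE/=; apply: CZ => //; apply: hbe.
    by exists w => //; rewrite wx.
  rewrite linearZ/= -{1}(limgE _ xU) ePe limgE// scalerA mulVf ?scale1r//.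
  by rewrite gt_eqF.
split.
  move=> i; apply/seteqP; split => [x [xi xN] /=|x /= ->]; last first.
    by split; exists [::]; rewrite ?mem0v// => y.
  (* The projection [e i] fixes the span of its own summand and kills the span of the others. *)
  have x1 : e i x = x.
    have : x \in lker (e i - \1)%VF.
      apply: lspan_sub xi => _ [c Cc <-] /=.
      by rewrite memv_ker add_lfunE opp_lfunE id_lfunE ee subrr.
    by rewrite memv_ker add_lfunE opp_lfunE id_lfunE subr_eq0 => /eqP.
  rewrite -x1; apply/eqP; rewrite -memv_ker.
  apply: lspan_sub xN => _ [j /= ji [c Cc <-]] /=.
  by rewrite memv_ker eo (eq_sym i) (negPf ji).
apply/seteqP; split => [x Cx|_ [y yi ->]] /=.
  by exists (fun i => e i x) => // i; exists x.
apply: (big_ind C) => // i _; have [c Cc <-] := yi i; exact: eCC.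
Qed.

(** * Direct sums of Lorentz cones *)

(** The quadratic description presents the cone as an intersection of preimages of a closed
    half-line under polynomial functions of the coordinates. *)
Lemma closed_lorentz_cone (R : realType) n : vclosed (@lorentz_cone R n).
Proof.
pose b := vbasis {:'rV[R]_n.+1}; pose c (u : 'rV[R]_(\dim {:'rV[R]_n.+1})) i : R := passmx.vecof b u 0 i.
have cc i : continuous (c ^~ i).
  have -> : c ^~ i = fun u => \sum_j u 0 j * b`_j 0 i.
    by apply/funext => u; rewrite /c /passmx.vecof summxE; apply: eq_bigr => j _; rewrite mxE.
  apply: continuous_big => [|j _ u]; first exact: add_continuous.
  by apply: continuousM; [exact: coord_continuous|exact: cst_continuous].
rewrite /vclosed; have -> : passmx.vecof b @^-1` @lorentz_cone R n =
    (c ^~ ord0) @^-1` [set t | 0 <= t] `&`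
    (fun u => c u ord0 * c u ord0 - \sum_i c u (lift ord0 i) * c u (lift ord0 i))
      @^-1` [set t | 0 <= t].
  by apply/seteqP; split=> u; rewrite /= lorentz_cone_form.
apply: closedI; apply: preimage_closed => //; try exact: closed_ge.
have cc2 i : continuous (fun u => c u i * c u i).
  by move=> u; exact: (cvgM (cc i u) (cc i u)).
have csum : continuous (fun u => \sum_i c u (lift ord0 i) * c u (lift ord0 i)).
  by apply: continuous_big => [|j _]; [exact: add_continuous|exact: cc2].
by move=> u _; exact: (cvgB (cc2 ord0 u) (csum u)).
Qed.

Lemma proper_lorentz_cone (R : realType) n : proper_cone (@lorentz_cone R n).
Proof.
have L0 : lorentz_cone (0 : 'rV[R]_n.+1).
  by rewrite -(scale0r (delta_mx 0 ord0)); apply/lorentz_coneE; rewrite space_dotZl !mxE !mul0r expr0n.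
split; [split|exact: closed_lorentz_cone| |exact: lspan_lorentz_cone].
- exact: L0.
- by move=> x y; exact: lorentz_coneD.
- by move=> a x; exact: lorentz_coneZ.
apply/seteqP; split => [x [Lx [y Ly yx]]|_ ->] /=; last by split=> //; exists 0; rewrite ?oppr0.
have x0 : x 0 ord0 = 0.
  move/lorentz_coneE: Lx => [x0 _]; move/lorentz_coneE: Ly => [y0 _].
  by apply/eqP; rewrite eq_le x0 -yx mxE oppr_le0 y0.
apply: lorentz_form_isotropic => //; move/lorentz_coneE: Lx => [_].
rewrite x0 expr0n/= => s0; rewrite /lorentz_form x0 mul0r sub0r; apply/eqP.
by rewrite oppr_eq0 eq_le s0 space_dot_ge0.
Qed.

Lemma lorentzian_lorentz_cone (R : realType) n : lorentzian (@lorentz_cone R n).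
Proof.
apply: (@lorentzian_coord _ _ _ fullv n \1%VF).
- by rewrite lspan_lorentz_cone; apply/seteqP; split => // x _; exact: memvf.
- by move=> x _; rewrite lfunE.
- by move=> r; exists r; rewrite ?memvf ?lfunE.
- by move=> x _; rewrite lfunE.
Qed.

(** * Linear spans, and coordinates on a direct sum of Lorentz cones *)

Section Lspan.
Variables (R : realType) (V : vectType R) (C : set V).

Lemma lspan0 : lspan C 0.
Proof. by exists [::] => //; exact: mem0v. Qed.

Lemma lspanD x y : lspan C x -> lspan C y -> lspan C (x + y).
Proof.
move=> [s sC xs] [t tC yt]; exists (s ++ t).
  by move=> z /=; rewrite mem_cat => /orP[/sC|/tC].
by rewrite span_cat memv_add.
Qed.

Lemma lspanZ (a : R) x : lspan C x -> lspan C (a *: x).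
Proof. by move=> [s sC xs]; exists s => //; exact: memvZ. Qed.

Lemma lspan_sum (I : Type) (r : seq I) (P : pred I) (F : I -> V) :
  (forall i, P i -> lspan C (F i)) -> lspan C (\sum_(i <- r | P i) F i).
Proof. by move=> CF; elim/big_ind: _ => //; [exact: lspan0|exact: lspanD]. Qed.

Lemma lspanS (D : set V) : C `<=` D -> lspan C `<=` lspan D.
Proof. by move=> CD x [s sC xs]; exists s => // y /sC/CD. Qed.

End Lspan.

(** Choosing preimages of the standard basis vectors gives a linear right inverse of [g] after
    [f]. *)
Lemma lorentz_lift (R : realType) (V W : vectType R) (L : set W) n
    (f : 'Hom(V, W)) (g : 'Hom(W, 'rV[R]_n.+1)) :
  set_bij (lspan L) (lspan (@lorentz_cone R n)) g ->
  (forall w, lspan L w -> exists v, f v = w) ->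
  exists h : 'Hom('rV[R]_n.+1, V), forall y, lspan L (f (h y)) /\ g (f (h y)) = y.
Proof.
move=> [_ _ gsurj] fsurj.
have /choice [v vP] j : exists v, lspan L (f v) /\ g (f v) = delta_mx 0 j.
  have [|w Lw wj] := gsurj (delta_mx 0 j); first by rewrite lspan_lorentz_cone.
  by have [v vw] := fsurj w Lw; exists v; rewrite vw.
have [h hE] : exists h : 'Hom('rV[R]_n.+1, V), h =1 fun y => \sum_j y 0 j *: v j.
  apply: linear_lfun => a x y; rewrite scaler_sumr -big_split/=.
  by apply: eq_bigr => j _; rewrite !mxE scalerDl scalerA.
exists h => y; rewrite hE linear_sum/=; split.
  by apply: lspan_sum => j _; rewrite linearZ; apply: lspanZ; exact: (vP j).1.
rewrite linear_sum/= [RHS]row_sum_delta; apply: eq_bigr => j _.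
by rewrite !linearZ/= (vP j).2.
Qed.

(** The decomposition of [D], which may live in another space without spanning it, is pulled back to
    [V] with standard Lorentz cones as summands. *)
Lemma lorentz_sum_coordinates (R : realType) (V W : vectType R) (C : set V) (D : set W)
    k (L : 'I_k -> set W) :
  lspan C = setT -> (forall i, lorentzian (L i)) -> direct_sum L D ->
  cone_isomorphic C D ->
  exists (n : 'I_k -> nat) (h : forall i, 'Hom('rV[R]_(n i).+1, V)),
    [/\ forall i y, lorentz_cone y -> C (h i y),
        forall x, C x -> exists2 y : forall i, 'rV[R]_(n i).+1,
          forall i, lorentz_cone (y i) & x = \sum_i h i (y i)
      & forall y : (forall i, 'rV[R]_(n i).+1), \sum_i h i (y i) = 0 -> forall i, y i = 0].
Proof.
move=> lC Llor [Lind DE] [f [fbij fC]].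
have [n nP] := choice Llor.
pose g i := sval (cid (nP i)).
have gbij i : set_bij (lspan (L i)) (lspan (@lorentz_cone R (n i))) (g i).
  by have [] := svalP (cid (nP i)).
have gL i : g i @` L i = @lorentz_cone R (n i) by have [] := svalP (cid (nP i)).
have ginj i x y : lspan (L i) x -> lspan (L i) y -> g i x = g i y -> x = y.
  by move=> Lx Ly; have [_ gi _] := gbij i; apply: gi; rewrite inE.
have finj x y : f x = f y -> x = y.
  by have [_ fi _] := fbij; apply: fi; rewrite lC inE.
(* A summand contains 0 because its isomorphic image does; filling the other slots with 0 then puts
   it inside [D]. *)
have L0 i : L i 0.
  have : (g i @` L i) 0 by rewrite gL; have [[]] := proper_lorentz_cone R (n i).
  move=> [x Lx gx0]; rewrite (ginj i 0 x) ?linear0//; first exact: lspan0.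
  exact: sub_lspan.
have LD i : L i `<=` D.
  move=> x Lx; rewrite DE; exists (fun j => if j == i then x else 0).
    by move=> j; case: eqVneq => [->|].
  by rewrite (bigD1 i)//= eqxx big1 ?addr0// => j /negPf ->.
have lift i : exists h : 'Hom('rV[R]_(n i).+1, V), forall y,
    lspan (L i) (f (h y)) /\ g i (f (h y)) = y.
  apply: lorentz_lift (gbij i) _ => w /(lspanS (@LD i)) Dw.
  by have [_ _ fs] := fbij; have [v _ vw] := fs w Dw; exists v.
pose h i := sval (cid (lift i)).
have hL i y : lspan (L i) (f (h i y)) := (svalP (cid (lift i)) y).1.
have hg i y : g i (f (h i y)) = y := (svalP (cid (lift i)) y).2.
have fh i w : L i w -> f (h i (g i w)) = w.
  by move=> Lw; apply: (ginj i); rewrite ?hg//; exact: sub_lspan.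
exists n, h; split.
- move=> i y; rewrite -gL => -[w Lw <-].
  have : (f @` C) w by rewrite fC; exact: LD Lw.
  by move=> [c Cc cw]; have <- // : c = h i (g i w); apply: finj; rewrite fh.
- move=> x Cx; have : D (f x) by rewrite -fC; exists x.
  rewrite DE => -[w wL fx]; exists (fun i => g i (w i)).
    by move=> i; rewrite -gL; exists (w i).
  by apply: finj; rewrite fx linear_sum/=; apply: eq_bigr => i _; rewrite fh.
move=> y y0 i; rewrite -[y i](hg i).
suff -> : f (h i (y i)) = 0 by rewrite linear0.
(* This component is also minus the sum of the others, hence in the span of the other summands. *)
suff : (lspan (L i) `&` lspan (\bigcup_(j in [set j | j != i]) L j)) (f (h i (y i))).
  by rewrite Lind.
split=> //.
have -> : f (h i (y i)) = (-1) *: \sum_(j | j != i) f (h j (y j)).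
  move/(congr1 f): y0; rewrite linear_sum linear0 (bigD1 i)//= => /eqP.
  by rewrite addr_eq0 => /eqP ->; rewrite scaleN1r.
apply: lspanZ; apply: lspan_sum => j ji.
by apply: lspanS (hL j (y j)) => w Lw; exists j.
Qed.

(** A positive [P] is the sum over [i] of [P] after [h i] after [al i], where [al i] reads off the
    component in the [i]-th Lorentz cone. *)
Lemma lorentz_sum_LFP (R : realType) (V W : vectType R) (C : set V) (D : set W)
    k (L : 'I_k -> set W) :
  proper_cone C -> (forall i, lorentzian (L i)) -> direct_sum L D ->
  cone_isomorphic C D -> LFP C C.
Proof.
move=> hC Llor LD CD; have [[C0 Cadd CZ] _ _ lC] := hC.
apply/seteqP; split.
  move=> _ [m [a [v [a0 _ vP ->]]]] _ [x Cx <-].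
  rewrite sum_lfunE; apply: (big_ind C) => // j _; rewrite scale_lfunE.
  apply: (CZ (a j)) => //; have [U [M [al [be [_ _ hal hbe ->]]]]] := vP j.
  by rewrite comp_lfunE; apply: hbe; exists (al x) => //; apply: hal; exists x.
have [n [h [hC' hsum hind]]] := lorentz_sum_coordinates lC Llor LD CD.
pose U i := limg (h i).
pose S := (\sum_i U i)%VS.
have CS x : C x -> x \in S.
  move=> /hsum [y _ ->]; apply: memv_sumr => i _; exact: memv_img (memvf _).
have xS x : x \in S by have : lspan C x; [rewrite lC|apply: lspan_sub].
pose al i := ((h i)^-1 \o sumv_pi S i)%VF.
have hal i x : h i (al i x) = sumv_pi S i x.
  by rewrite comp_lfunE limg_lfunVK// memv_sum_pi.
have alE x : \sum_i h i (al i x) = x.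
  by under eq_bigr do rewrite hal; exact: sumv_pi_sum (xS x).
(* A point of [C] has a decomposition with components in the Lorentz cones, and by [hind] it is the
   one given by [al]. *)
have alC i x : C x -> lorentz_cone (al i x).
  move=> /hsum [y yL xy]; suff /eqP : y i - al i x = 0 by rewrite subr_eq0 => /eqP <-.
  apply: (hind (fun i => y i - al i x)).
  under eq_bigr do rewrite linearB/=.
  by rewrite sumrB -xy alE subrr.
move=> P PC.
(* The sum becomes a convex combination with equal weights [1/c], each map being multiplied by [c].
   The extra index [ord0] carries the zero map, so the weights sum to 1 even for [k = 0]. *)
pose c : R := k.+1%:R.
have c0 : 0 < c by rewrite ltr0n.
exists k.+1, (fun=> c^-1),
  (fun j => if unlift ord0 j is Some i then (c *: (P \o h i) \o al i)%VF else 0).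
split.
- by move=> _; rewrite invr_ge0 ltW.
- by rewrite sumr_const card_ord -[_ *+ _]mulr_natl mulfV// gt_eqF.
- move=> j; case: (unliftP ord0 j) => [i _|_].
    exists _, (@lorentz_cone R (n i)), (al i), (c *: (P \o h i))%VF; split.
    + exact: lorentzian_lorentz_cone.
    + exact: proper_lorentz_cone.
    + by move=> _ [x Cx <-]; exact: alC.
    + move=> _ [y Ly <-]; rewrite scale_lfunE comp_lfunE; apply: CZ; first exact: ltW.
      by apply: PC; exists (h i y) => //; exact: hC'.
    + by [].
  exists _, (@lorentz_cone R 0), 0, 0; split.
  + exact: lorentzian_lorentz_cone.
  + exact: proper_lorentz_cone.
  + move=> _ [x _ <-]; rewrite zero_lfunE.
    by have [[]] := proper_lorentz_cone R 0.
  + by move=> _ [x _ <-]; rewrite zero_lfunE.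
  + by rewrite comp_lfun0l.
rewrite big_ord_recl unlift_none scaler0 add0r; apply/lfunP => x.
rewrite -[in LHS](alE x) linear_sum sum_lfunE; apply: eq_bigr => i _.
rewrite liftK [RHS]scale_lfunE [X in _ = _ *: X]comp_lfunE scale_lfunE (comp_lfunE P).
rewrite scalerA mulVf ?scale1r//.
by rewrite gt_eqF.
Qed.

Theorem theorem1 (R : realType) (V : vectType R) (C : set V)
    (hC : proper_cone C) :
  LFP C C <->
  exists (W : vectType R) (D : set W) (k : nat) (L : 'I_k -> set W),
    (forall i : 'I_k, lorentzian (L i)) /\
    direct_sum L D /\
    cone_isomorphic C D.
Proof.
split=> [/(LFP_lorentz_sum hC) [k [L [Llor LC]]]|[W [D [k [L [Llor [LD CD]]]]]]].
  exists V, C, k, L; split=> //; split=> //; exists \1%VF; split.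
    split=> [x|x y _ _|x Cx]; rewrite ?lfunE//.
    by exists x; rewrite ?lfunE.
  by apply/seteqP; split=> [_ [x Cx <-]|x Cx]; [rewrite lfunE|exists x; rewrite ?lfunE].
exact: lorentz_sum_LFP hC Llor LD CD.
Qed.
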